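(* For integers $0 \le i < r \le k$ let $p_r = x_1\cdots x_r$, $q_r = y_1 \cdots y_r$, let $$\hat{Z}_{r,k} = (p_{r+1}q_r,\, x_{r+2},\dots,x_k,\, y_{r+1},\dots,y_k),$$ and let $$R_{i,r,k} = \frac{p_k q_r}{(1-p_k)(1-p_r q_r)}\, Q_i \, Q_{k-r}(\hat{Z}_{r,k}).$$ Then $Q_0 = 1$, and for every integer $k > 0$, $$Q_k = \frac{x_k Q_{k-1}}{1-p_k} + \sum_{0 \le i < r \le k} R_{i,r,k}.$$
   Context: For a nonnegative integer $k$, $\Lambda(k)$ denotes the set of integer partitions $\lambda = (\lambda_1 \ge \cdots \ge \lambda_k)$ of length exactly $k$, i.e. with $\lambda_k > 0$ (for $k=0$ only the empty partition). For partitions, $\mu \le \lambda$ denotes the order of the Young lattice, i.e. $\mu_j \le \lambda_j$ for all $j$ (partitions being padded with zeros). With $\mathbf{x} = (x_1,\dots,x_k)$ and $\mathbf{y} = (y_1,\dots,y_k)$, write $\mathbf{x}^{\lambda} = x_1^{\lambda_1}\cdots x_k^{\lambda_k}$ and $\mathbf{y}^{\mu} = y_1^{\mu_1}\cdots y_k^{\mu_k}$. Define the formal power series $$Q_k = Q_k(\mathbf{x},\mathbf{y}) = Q_k(x_1,\dots,x_k,y_1,\dots,y_k) = \sum_{\lambda \in \Lambda(k)} \ \sum_{\emptyset \le \mu \le \lambda} \mathbf{y}^{\mu}\mathbf{x}^{\lambda}.$$ An unadorned $Q_i$ means $Q_i(x_1,\dots,x_i,y_1,\dots,y_i)$. The expression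 $Q_{k-r}(\hat{Z}_{r,k})$ means the series $Q_{k-r}$ in its $2(k-r)$ variables, with its $k-r$ ''$x$-variables'' replaced in order by $p_{r+1}q_r, x_{r+2},\dots,x_k$ and its $k-r$ ''$y$-variables'' replaced in order by $y_{r+1},\dots,y_k$; for $r=k$ the list $\hat{Z}_{k,k}$ is empty and $Q_0(\hat Z_{k,k}) = Q_0$. Fractions are interpreted as formal power series via geometric series (equivalently as rational functions). *)

(* Defs.v *)
From HB Require Import structures.
From mathcomp Require Import all_boot all_order all_algebra.
From mathcomp Require Import zify mpoly.
From mathcomp Require Import boolp classical_sets functions cardinality fsbigop.

Set Implicit Arguments.
Unset Strict Implicit.
Unset Printing Implicit Defensive.

Import GRing.Theory.
Local Open Scope ring_scope.
Local Open Scope classical_set_scope.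

(** Formal power series in [n] commuting variables, as coefficient functions
    on the monomials ['X_{1..n}]. *)

Record mfps (n : nat) (R : Type) := MFps { mfcoef : 'X_{1..n} -> R }.

Notation "f @~ m" := (mfcoef f m) (at level 2, m at level 2, format "f @~ m") : ring_scope.

HB.instance Definition _ (n : nat) (R : Type) := gen_eqMixin (mfps n R).
HB.instance Definition _ (n : nat) (R : Type) := gen_choiceMixin (mfps n R).

Lemma mfpsP (n : nat) (R : Type) (f g : mfps n R) :
  (forall m, f@~m = g@~m) -> f = g.
Proof. by case: f g => f [g] /= /funext ->. Qed.

Section Ring.
Variables (n : nat) (R : comNzRingType).
Implicit Types (f g h : mfps n R) (m : 'X_{1..n}).

Definition mfpsC (c : R) : mfps n R := MFps (fun m => if m == 0%MM then c else 0).

Definition mfpsX (i : 'I_n) : mfps n R := MFps (fun m => (m == U_(i)%MM)%:R).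

Definition mfps_opp f : mfps n R := MFps (fun m => - f@~m).

Definition mfps_add f g : mfps n R := MFps (fun m => f@~m + g@~m).

Definition mfps_mul f g : mfps n R := MFps (fun m =>
  \sum_(k : 'X_{1..n < (mdeg m).+1, (mdeg m).+1} | m == (k.1 + k.2)%MM)
     f@~(k.1) * g@~(k.2)).

Fact mfps_addA : associative mfps_add.
Proof. by move=> f g h; apply: mfpsP => m /=; rewrite addrA. Qed.
Fact mfps_addC : commutative mfps_add.
Proof. by move=> f g; apply: mfpsP => m /=; rewrite addrC. Qed.
Fact mfps_add0 : left_id (mfpsC 0) mfps_add.
Proof. by move=> f; apply: mfpsP => m /=; rewrite if_same add0r. Qed.
Fact mfps_addN : left_inverse (mfpsC 0) mfps_opp mfps_add.
Proof. by move=> f; apply: mfpsP => m /=; rewrite if_same addNr. Qed.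

HB.instance Definition _ := GRing.isZmodule.Build (mfps n R)
  mfps_addA mfps_addC mfps_add0 mfps_addN.

(** The ring axioms are transported from {mpoly R[n]} by truncation. *)
Definition mfps_trunc d f : {mpoly R[n]} :=
  \sum_(m : 'X_{1..n < d}) f@~m *: 'X_[m].

Lemma mcoeff_trunc d f m : (mdeg m < d)%N -> (mfps_trunc d f)@_m = f@~m.
Proof. exact: mcoeff_mpoly. Qed.

Lemma eq_mcoeffM d (p p' q q' : {mpoly R[n]}) m :
  (forall a, (mdeg a < d)%N -> p@_a = p'@_a) ->
  (forall a, (mdeg a < d)%N -> q@_a = q'@_a) ->
  (mdeg m < d)%N -> (p * q)@_m = (p' * q')@_m.
Proof.
move=> hp hq md; rewrite !mcoeffM; apply: eq_bigr => -[[a la] [b lb]] /= _.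
by rewrite hp ?hq //; [move: lb | move: la] => /leq_trans; apply.
Qed.

Lemma mfps_mulE d f g m : (mdeg m < d)%N ->
  (mfps_mul f g)@~m = (mfps_trunc d f * mfps_trunc d g)@_m.
Proof.
move=> md; rewrite mcoeffM /=; apply: eq_bigr => -[[a la] [b lb]] /= _.
by rewrite !mcoeff_trunc //; [move: lb | move: la] => /leq_trans; apply.
Qed.

Fact mfps_mulA : associative mfps_mul.
Proof.
move=> f g h; apply: mfpsP => m; pose d := (mdeg m).+1.
rewrite !(@mfps_mulE d) //.
rewrite (@eq_mcoeffM d _ (mfps_trunc d f) _ (mfps_trunc d g * mfps_trunc d h)) //.
  rewrite mulrA; apply: (@eq_mcoeffM d) => // a ad.
  by rewrite mcoeff_trunc // -mfps_mulE.
by move=> a ad; rewrite mcoeff_trunc // -mfps_mulE.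
Qed.
Fact mfps_mulC : commutative mfps_mul.
Proof.
move=> f g; apply: mfpsP => m.
by rewrite !(@mfps_mulE (mdeg m).+1) // mulrC.
Qed.
Fact mfps_mul1 : left_id (mfpsC 1) mfps_mul.
Proof.
move=> f; apply: mfpsP => m; rewrite (@mfps_mulE (mdeg m).+1) //.
rewrite (@eq_mcoeffM (mdeg m).+1 _ 1 _ (mfps_trunc (mdeg m).+1 f)) //.
  by rewrite mul1r mcoeff_trunc.
by move=> a ad; rewrite mcoeff_trunc // mcoeff1 /=; case: eqP.
Qed.
Fact mfps_mulDl : left_distributive mfps_mul mfps_add.
Proof.
move=> f g h; apply: mfpsP => m /=; rewrite -big_split /=.
by apply: eq_bigr => k _; rewrite mulrDl.
Qed.
Fact mfps_oner_neq0 : mfpsC 1 != 0.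
Proof.
apply/eqP => /(congr1 (fun f => f@~0%MM)) /=.
by rewrite eqxx; apply/eqP/oner_neq0.
Qed.

HB.instance Definition _ := GRing.Zmodule_isComNzRing.Build (mfps n R)
  mfps_mulA mfps_mulC mfps_mul1 mfps_mulDl mfps_oner_neq0.

Lemma mfcoef0 m : (0 : mfps n R)@~m = 0.
Proof. exact: if_same. Qed.

Lemma mfcoef1 m : (1 : mfps n R)@~m = (m == 0%MM)%:R.
Proof. by rewrite /=; case: eqP. Qed.

Lemma mfcoefD f g m : (f + g)@~m = f@~m + g@~m.
Proof. by []. Qed.

Lemma mfcoefN f m : (- f)@~m = - f@~m.
Proof. by []. Qed.

Lemma mfcoefM f g m : (f * g)@~m =
  \sum_(k : 'X_{1..n < (mdeg m).+1, (mdeg m).+1} | m == (k.1 + k.2)%MM)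
     f@~(k.1) * g@~(k.2).
Proof. by []. Qed.

(** Possibly infinite sums are taken coefficientwise.  A coefficient to which
    infinitely many terms contribute is set to 0 by [\sum_(i \in A)]; every
    family summed below is locally finite. *)
Definition mfps_sum (I : choiceType) (A : set I) (F : I -> mfps n R) : mfps n R :=
  MFps (fun m => \sum_(i \in A) (F i)@~m).

(** 1/(1 - f) as the geometric series 1 + f + f^2 + ..., for [f] with zero
    constant term. *)
Definition mfps_geom f : mfps n R := mfps_sum [set: nat] (fun e => f ^+ e).

Lemma mfcoefM_lt f g d e m :
  (forall a, (mdeg a < d)%N -> f@~a = 0) -> (forall a, (mdeg a < e)%N -> g@~a = 0) ->
  (mdeg m < d + e)%N -> (f * g)@~m = 0.
Proof.
move=> f0 g0 me; rewrite mfcoefM big1 // => -[[a la] [b lb]] /= /eqP def_m.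
have [ad|ad] := ltnP (mdeg a) d; first by rewrite f0 ?mul0r.
by rewrite g0 ?mulr0 //; move: me; rewrite def_m mdegD; lia.
Qed.

Lemma mfcoefX_lt f (e : nat) m : f@~0%MM = 0 -> (mdeg m < e)%N -> (f ^+ e)@~m = 0.
Proof.
move=> f0; elim: e m => // e IHe m me; rewrite exprS.
apply: (@mfcoefM_lt _ _ 1 e) => // a; rewrite ltnS leqn0 mdeg_eq0.
by move=> /eqP ->.
Qed.

Lemma mfps_geomE f m d : f@~0%MM = 0 -> (mdeg m < d)%N ->
  (mfps_geom f)@~m = (\sum_(e < d) f ^+ e)@~m.
Proof.
move=> f0 md; rewrite /= (fsbigE (index_iota 0 d)) ?iota_uniq //; last first.
  by move=> e _; rewrite mem_index_iota /= -leqNgt => de;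
    rewrite mfcoefX_lt // (leq_trans md).
rewrite (eq_bigl xpredT); last by move=> e; rewrite in_setT.
rewrite big_mkord.
by elim/big_rec2: _ => [|e u v _ ->]; rewrite ?mfcoef0 ?mfcoefD.
Qed.

Lemma mfps_geomP f : f@~0%MM = 0 -> (1 - f) * mfps_geom f = 1.
Proof.
move=> f0; apply: mfpsP => m; pose d := (mdeg m).+1.
have -> : ((1 - f) * mfps_geom f)@~m = ((1 - f) * \sum_(e < d) f ^+ e)@~m.
  rewrite !mfcoefM; apply: eq_bigr => -[[a la] [b lb]] /= _.
  by rewrite -(mfps_geomE f0 lb).
have -> : (1 - f) * \sum_(e < d) f ^+ e = 1 - f ^+ d.
  by rewrite -opprB mulNr -subrX1 opprB.
rewrite mfcoefD mfcoefN.
by rewrite mfcoefX_lt // subr0.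
Qed.

Definition mfps_mon m : mfps n R := MFps (fun a => (a == m)%:R).

Lemma mfps_mon0 : mfps_mon 0%MM = 1.
Proof. by apply: mfpsP => a; rewrite mfcoef1. Qed.

Lemma mfps_monD m1 m2 : mfps_mon (m1 + m2)%MM = mfps_mon m1 * mfps_mon m2.
Proof.
apply: mfpsP => a; transitivity (('X_[m1] * 'X_[m2] : {mpoly R[n]})@_a).
  by rewrite -mpolyXD mcoeffX eq_sym.
rewrite mcoeffM mfcoefM; apply: eq_bigr => k _ /=.
by rewrite !mcoeffX (eq_sym m1) (eq_sym m2).
Qed.

Lemma mfps_monX m e : mfps_mon (m *+ e)%MM = mfps_mon m ^+ e.
Proof.
elim: e => [|e IHe]; first by rewrite mulm0n mfps_mon0.
by rewrite mulmS mfps_monD IHe exprS.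
Qed.

Lemma mfps_mon_sum (I : finType) (F : I -> 'X_{1..n}) :
  mfps_mon (\sum_i F i)%MM = \prod_i mfps_mon (F i).
Proof. exact: (big_morph _ mfps_monD mfps_mon0). Qed.

End Ring.

(** The substitution F(g_0, ..., g_{n-1}), for [g] with zero constant terms. *)
Definition mfps_comp (R : comNzRingType) (n k : nat)
    (F : mfps n R) (g : 'I_n -> mfps k R) : mfps k R :=
  mfps_sum [set: 'X_{1..n}] (fun a => mfpsC k F@~a * \prod_(i < n) g i ^+ a i).

Lemma mfps_comp_lt (R : comNzRingType) (n k : nat) (F : mfps n R)
    (g : 'I_n -> mfps k R) (a : 'X_{1..n}) (m : 'X_{1..k}) :
  (forall i, (g i)@~0%MM = 0) -> (mdeg m < mdeg a)%N ->
  (mfpsC k F@~a * \prod_(i < n) g i ^+ a i)@~m = 0.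
Proof.
move=> g0; rewrite -[mdeg a]add0n; apply: mfcoefM_lt => // {}m.
rewrite (mdegE a); move: m.
pose P (d : nat) (f : mfps k R) := forall m, (mdeg m < d)%N -> f@~m = 0.
rewrite -/(P _ _).
elim/big_ind2: _ => // [e f d h Pf Ph b bd|i _ b]; last exact: mfcoefX_lt.
exact: mfcoefM_lt Pf Ph bd.
Qed.

Lemma mfps_compE (R : comNzRingType) (n k : nat) (F : mfps n R)
    (g : 'I_n -> mfps k R) (m : 'X_{1..k}) d :
  (forall i, (g i)@~0%MM = 0) -> (mdeg m < d)%N ->
  (mfps_comp F g)@~m =
  (\sum_(a : 'X_{1..n < d}) mfpsC k F@~a * \prod_(i < n) g i ^+ a i)@~m.
Proof.
move=> g0 md; rewrite /=.
rewrite (fsbigE [seq bmnm a | a : 'X_{1..n < d}]); last 3 first.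
- by rewrite map_inj_uniq ?enum_uniq //; exact: val_inj.
- by [].
- move=> a _ /negP a_d; apply: mfps_comp_lt => //.
  rewrite (leq_trans md) // leqNgt; apply/negP => ad; apply: a_d.
  by apply/mapP; exists (BMultinom ad); rewrite // mem_enum.
rewrite (eq_bigl xpredT); last by move=> e; rewrite in_setT.
rewrite big_map big_enum /=.
by elim/big_rec2: _ => [|e u v _ ->]; rewrite ?mfcoef0 ?mfcoefD.
Qed.

(** The series live in k + k variables: x_j and y_j, with 1 <= j <= k, are the
    variables of index j - 1 and k + (j - 1).  Other values of j give 0 and are
    never used. *)

Definition xvar (k j : nat) : mfps (k + k) int :=
  if j is j'.+1 then oapp (fun i : 'I_k => mfpsX int (lshift k i)) 0 (insub j')
  else 0.

Definition yvar (k j : nat) : mfps (k + k) int :=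
  if j is j'.+1 then oapp (fun i : 'I_k => mfpsX int (rshift k i)) 0 (insub j')
  else 0.

Definition xmon (k : nat) (l : k.-tuple nat) : mfps (k + k) int :=
  \prod_(j < k) xvar k j.+1 ^+ tnth l j.

Definition ymon (k : nat) (u : k.-tuple nat) : mfps (k + k) int :=
  \prod_(j < k) yvar k j.+1 ^+ tnth u j.

(** Partitions with at most k parts are weakly decreasing k-tuples, padded with
    zeros; [Lambda k] consists of those with exactly k nonzero parts. *)

Definition Lambda (k : nat) : set (k.-tuple nat) :=
  [set l : k.-tuple nat | sorted geq l && all (ltn 0) l].
Arguments Lambda : clear implicits.

(** The interval from the empty partition to [l] in the Young lattice: as [l]
    has k parts, a partition below [l] has at most k parts. *)
Definition young_below (k : nat) (l : k.-tuple nat) : set (k.-tuple nat) :=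
  [set u : k.-tuple nat | sorted geq u && [forall j, (tnth u j <= tnth l j)%N]].

Definition Q (k : nat) : mfps (k + k) int :=
  mfps_sum (Lambda k) (fun l =>
    mfps_sum (young_below l) (fun u => ymon u * xmon l)).

Lemma xmonE k (l : k.-tuple nat) :
  xmon l = mfps_mon int (\sum_(j < k) U_(lshift k j) *+ tnth l j)%MM.
Proof. by rewrite mfps_mon_sum; apply: eq_bigr => j _; rewrite /= valK mfps_monX. Qed.

Lemma ymonE k (u : k.-tuple nat) :
  ymon u = mfps_mon int (\sum_(j < k) U_(rshift k j) *+ tnth u j)%MM.
Proof. by rewrite mfps_mon_sum; apply: eq_bigr => j _; rewrite /= valK mfps_monX. Qed.

Lemma mfcoef_yxmon k (l u : k.-tuple nat) m : (ymon u * xmon l)@~m =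
  (([tuple m (lshift k j) | j < k] == l) && ([tuple m (rshift k j) | j < k] == u))%:R.
Proof.
rewrite xmonE ymonE -mfps_monD /=; congr (_%:R); congr nat_of_bool.
apply/eqP/andP => [-> | [/eqP <- /eqP <-]].
  split; apply/eqP/eq_from_tnth => i; rewrite tnth_mktuple mnmDE !mnm_sumE.
    rewrite big1 ?add0n => [|j _]; last by rewrite mulmnE mnm1E eq_rlshift.
    rewrite (bigD1 i) //= mulmnE mnm1E eqxx mul1n big1 ?addn0 // => j ji.
    by rewrite mulmnE mnm1E eq_lshift (negbTE ji).
  rewrite [X in (_ + X)%N]big1 ?addn0 => [|j _]; last by rewrite mulmnE mnm1E eq_lrshift.
  rewrite (bigD1 i) //= mulmnE mnm1E eqxx mul1n big1 ?addn0 // => j ji.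
  by rewrite mulmnE mnm1E eq_rshift (negbTE ji).
apply/mnmP => i; rewrite mnmDE !mnm_sumE -[i]fintype.splitK; case: (fintype.split i) => j /=.
  rewrite big1 ?add0n => [|a _]; last by rewrite mulmnE mnm1E eq_rlshift.
  rewrite (bigD1 j) //= mulmnE mnm1E eqxx mul1n tnth_mktuple big1 ?addn0 // => a ja.
  by rewrite mulmnE mnm1E eq_lshift (negbTE ja).
rewrite [X in (\big[_/_]_(_ <- _ | _) _ + X)%N]big1 ?addn0 => [|a _]; last by rewrite mulmnE mnm1E eq_lrshift.
rewrite (bigD1 j) //= mulmnE mnm1E eqxx mul1n tnth_mktuple big1 ?addn0 // => a ja.
by rewrite mulmnE mnm1E eq_rshift (negbTE ja).
Qed.

Lemma fsbig_pred1 (I : choiceType) (A : set I) (i : I) (F : I -> int) :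
  (forall j, j != i -> F j = 0) -> \sum_(j \in A) F j = if i \in A then F i else 0.
Proof.
move=> F0; have [Ai|Ai] := boolP (i \in A).
  rewrite -(@fsbig_widen _ _ _ _ [set i] A) ?fsbig_set1 //.
    by move=> _ ->; exact: set_mem.
  by move=> j [_ ji]; apply: F0; apply/eqP.
apply: fsbig1 => j Aj; apply: F0; apply: contraNneq Ai => <-; exact: mem_set.
Qed.

Lemma mfcoef_Q k (m : 'X_{1..(k + k)}) :
  let l := [tuple m (lshift k j) | j < k] in
  let u := [tuple m (rshift k j) | j < k] in
  (Q k)@~m = ((l \in Lambda k) && (u \in young_below l))%:R.
Proof.
move=> l u; pose F l' u' := (ymon u' * xmon l' : mfps (k + k) int)@~m.
rewrite -[LHS]/(\sum_(l' \in Lambda k) \sum_(u' \in young_below l') F l' u').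
rewrite (@fsbig_pred1 _ _ l) => [|l' ll']; last first.
  by apply: fsbig1 => u' _; rewrite /F mfcoef_yxmon -/l eq_sym (negbTE ll').
rewrite (@fsbig_pred1 _ _ u) => [|u' uu']; last first.
  by rewrite /F mfcoef_yxmon -/u [u == _]eq_sym (negbTE uu') andbF.
by rewrite /F mfcoef_yxmon -/l -/u !eqxx; case: ifP => //; case: ifP.
Qed.

(** The series Q_i(u_1, ..., u_i, v_1, ..., v_i). *)
Definition Q_at (k i : nat) (u v : nat -> mfps (k + k) int) : mfps (k + k) int :=
  mfps_comp (Q i)
    (fun s => match fintype.split s with inl a => u a.+1 | inr b => v b.+1 end).

Definition p_ (k r : nat) : mfps (k + k) int := \prod_(1 <= j < r.+1) xvar k j.

Definition q_ (k r : nat) : mfps (k + k) int := \prod_(1 <= j < r.+1) yvar k j.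

(** Q_i(x_1, ..., x_i, y_1, ..., y_i), as a series in the variables for k. *)
Definition Q_sub (k i : nat) : mfps (k + k) int := Q_at i (xvar k) (yvar k).

(** Q_(k-r) at p_(r+1) q_r, x_(r+2), ..., x_k and y_(r+1), ..., y_k. *)
Definition Q_Zhat (k r : nat) : mfps (k + k) int :=
  Q_at (k - r)
    (fun j => if j == 1%N then p_ k r.+1 * q_ k r else xvar k (r + j))
    (fun j => yvar k (r + j)).

Definition R_ (i r k : nat) : mfps (k + k) int :=
  p_ k k * q_ k r * (mfps_geom (p_ k k) * mfps_geom (p_ k r * q_ k r))
  * Q_sub k i * Q_Zhat k r.

(* Main.v *)
From mathcomp Require Import all_boot all_order all_algebra.
From mathcomp Require Import zify mpoly.
From mathcomp Require Import boolp classical_sets functions cardinality fsbigop.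
Require Import Defs.

(** The series [Q k] enumerates the pairs (lambda, mu) with lambda a partition
    with exactly k parts and mu <= lambda, each pair contributing one monomial.
    The identity says that these pairs fall into disjoint classes, one for each
    term of the right-hand side, and is proved by exhibiting the classes.

    Put d_j = lambda_j - mu_j >= 0 for 1 <= j <= k, let D be the least d_j and r
    the last index at which it is attained.

    - If mu_k = 0 and lambda_k <= D + 1, subtracting lambda_k - 1 from every part
      of lambda leaves a pair whose lambda has last part 1 and whose mu still
      fits below the first k - 1 parts.  Such pairs are counted by
      x_k Q_(k-1) / (1 - p_k): this is [peelable_genfun].

    - Otherwise mu_r > 0, and lambda_j > D + 1 for every j > r.  Let i be the
      number of parts of lambda larger than lambda_r; then i < r.  Remove D + 1
      columns of height k from lambda.  What remains at r is lambda_r - D - 1,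
      which is mu_r - 1.  Let c be the remaining part at r + 1 (0 if r = k) and
      b = mu_r - 1 - c.  The pair is then the sum of D + 1 full columns of
      lambda, of b columns of height r of lambda and b + 1 of mu, of a pair with
      i parts (the excess of both partitions over their r-th parts), and of a
      pair on the indices r + 1, ..., k, whose first part c is also copied in
      lambda and mu at all the indices up to r.  These are the factors of
      R_(i,r,k), the last one being explained by the substitution of
      p_(r+1) q_r for the first variable: this is [R_genfun].

    Everything is phrased with series that have coefficients 0 and 1, that is
    with sets of monomials.  A product of two such series is again one as soon as
    the summands of a sum can be recovered from it ([genfun_mul]), and so is a
    geometric series of a monomial or a substitution of monomials under which no
    two monomials are merged ([genfun_geom], [genfun_comp]).  In R_(i,r,k) the
    factors are recovered by looking at the exponents of index r, where the pair
    with i < r parts vanishes.  It remains to see that every pair is in exactly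
    one class ([last_min_exists], [last_min_uniq], [peelable_last_min]).

    The parts are numbered from 0 in the code: the r-th part above is the
    exponent of index [r.-1]. *)

Set Implicit Arguments.
Unset Strict Implicit.
Unset Printing Implicit Defensive.

Import GRing.Theory.
Local Open Scope ring_scope.

(** * Series with coefficients 0 and 1 *)

Definition genfun n (S : set 'X_{1..n}) : mfps n int := MFps (fun m => `[< S m >]%:R).

Lemma genfun_mon n (m : 'X_{1..n}) : mfps_mon int m = genfun [set m]%classic.
Proof.
apply: mfpsP => a /=; congr (_%:R); congr nat_of_bool.
by apply/eqP/asboolP.
Qed.

(** The coefficient of a product at a monomial counts its decompositions as a sum
    from [S] and [T]; by hypothesis there is at most one, the second summand
    being determined by the first. *)
Lemma genfun_mul n (S T U : set 'X_{1..n}) :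
  (forall s t s' t', S s -> T t -> S s' -> T t' -> (s + t = s' + t')%MM -> s = s') ->
  (forall m, U m <-> exists s t, [/\ S s, T t & m = (s + t)%MM]) ->
  genfun S * genfun T = genfun U.
Proof.
move=> inj hU; apply: mfpsP => m; rewrite mfcoefM /=.
have [|nU] := asboolP (U m).
  move=> /hU [s [t [Ss Tt def_m]]].
  have ls : (mdeg s < (mdeg m).+1)%N by rewrite def_m mdegD ltnS leq_addr.
  have lt : (mdeg t < (mdeg m).+1)%N by rewrite def_m mdegD ltnS leq_addl.
  rewrite (bigD1 (BMultinom ls, BMultinom lt)) /= ?def_m ?eqxx //.
  rewrite !asboolT // mulr1 big1 ?addr0 // => -[[a la] [b lb]] /= /andP[/eqP e ne].
  case: asboolP => Sa; rewrite ?mul0r // ; case: asboolP => Tb; rewrite ?mulr0 //.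
  have sa : s = a := inj _ _ _ _ Ss Tt Sa Tb (etrans (esym def_m) e).
  have tb : t = b by apply/eqP; rewrite -(eqm_add2l s) -def_m e sa.
  by case/eqP: ne; congr pair; apply: val_inj.
rewrite big1 // => -[[a la] [b lb]] /= /eqP e.
case: asboolP => Sa; rewrite ?mul0r // ; case: asboolP => Tb; rewrite ?mulr0 //.
by case: nU; apply/hU; exists a, b.
Qed.

Lemma genfun_image n (I : choiceType) (A : set I) (w : I -> 'X_{1..n}) :
  (forall i j, A i -> A j -> w i = w j -> i = j) ->
  mfps_sum A (fun i => mfps_mon int (w i)) = genfun (w @` A)%classic.
Proof.
move=> inj; apply: mfpsP => m /=.
have [[i Ai <-]|no] := asboolP ((w @` A)%classic m).
  rewrite -(@fsbig_widen _ _ _ _ [set i]%classic A) ?fsbig_set1 ?eqxx //.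
    by move=> _ ->.
  move=> j [Aj ji] /=; case: eqP => // /inj e; case: ji; exact/esym/e.
by rewrite fsbig1 // => i Ai; case: eqP => // e; case: no; exists i.
Qed.

Lemma genfun_geom n (p : 'X_{1..n}) : p != 0%MM ->
  mfps_geom (mfps_mon int p) = genfun [set (p *+ e)%MM | e in [set: nat]]%classic.
Proof.
move=> p0; rewrite -genfun_image; last first.
  move=> i j _ _ /(congr1 (@mdeg n)); rewrite !mdegMn.
  by move: p0; rewrite -mdeg_eq0; nia.
apply: mfpsP => m /=.
by apply: eq_fsbigr => e _; rewrite -mfps_monX.
Qed.

(** Substituting monomials sends a monomial [a] to a monomial [phi a]; the
    coefficients stay 0 or 1 when no two elements of [S] are merged. *)
Lemma genfun_comp n k (S : set 'X_{1..n}) (g : 'I_n -> mfps k int) (W : 'I_n -> 'X_{1..k}) :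
  (forall s, g s = mfps_mon int (W s)) ->
  let phi (a : 'X_{1..n}) := (\sum_(s < n) W s *+ a s)%MM in
  (forall a b, S a -> S b -> phi a = phi b -> a = b) ->
  mfps_comp (genfun S) g = genfun (phi @` S)%classic.
Proof.
move=> gW phi inj; transitivity (mfps_sum [set: 'X_{1..n}]
    (fun a => if a \in S then mfps_mon int (phi a) else 0)).
  congr mfps_sum; apply/funext => a.
  have -> : \prod_(s < n) g s ^+ a s = mfps_mon int (phi a).
    by rewrite mfps_mon_sum; apply: eq_bigr => s _; rewrite gW mfps_monX.
  case: ifPn => [/set_mem Sa|/negP nSa] /=.
    by rewrite asboolT // -[RHS]mul1r.
  rewrite asboolF => [|/mem_set //].
  by rewrite -[RHS](mul0r (mfps_mon int (phi a))).
rewrite -genfun_image //; apply: mfpsP => m /=.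
rewrite (@fsbig_mkcond _ _ _ _ S); apply: eq_fsbigr => a _; rewrite /patch.
by case: ifP => // _; rewrite mfcoef0.
Qed.

(** * Exponents in the two families of variables *)

(** The exponents are read as functions on all of [nat], equal to 0 from [k] on:
    partitions padded with zeros then need no bounds on indices. *)
Definition xexp k (m : 'X_{1..k + k}) (j : nat) : nat :=
  oapp (fun t : 'I_k => m (lshift k t)) 0%N (insub j).

Definition yexp k (m : 'X_{1..k + k}) (j : nat) : nat :=
  oapp (fun t : 'I_k => m (rshift k t)) 0%N (insub j).

Definition mkmon k (f g : nat -> nat) : 'X_{1..k + k} :=
  [multinom match fintype.split s with inl t => f t | inr t => g t end | s < k + k].

Lemma xexp_ord k m (t : 'I_k) : xexp m t = m (lshift k t).
Proof. by rewrite /xexp valK. Qed.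

Lemma yexp_ord k m (t : 'I_k) : yexp m t = m (rshift k t).
Proof. by rewrite /yexp valK. Qed.

Lemma xexp_ge k (m : 'X_{1..k + k}) j : (k <= j)%N -> xexp m j = 0%N.
Proof. by move=> kj; rewrite /xexp insubN // -leqNgt. Qed.

Lemma yexp_ge k (m : 'X_{1..k + k}) j : (k <= j)%N -> yexp m j = 0%N.
Proof. by move=> kj; rewrite /yexp insubN // -leqNgt. Qed.

Lemma eq_xyexp k (m m' : 'X_{1..k + k}) :
  (forall j, (j < k)%N -> xexp m j = xexp m' j /\ yexp m j = yexp m' j) -> m = m'.
Proof.
move=> h; apply/mnmP => s; rewrite -[s]fintype.splitK.
by case: (fintype.split s) => t /=; have [] := h t (ltn_ord t);
  rewrite ?xexp_ord ?yexp_ord.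
Qed.

Lemma xexp_mk k f g j : xexp (mkmon k f g) j = if (j < k)%N then f j else 0%N.
Proof.
case: ltnP => jk; last exact: xexp_ge.
by rewrite -[j]/(nat_of_ord (Ordinal jk)) xexp_ord mnmE (unsplitK (inl (Ordinal jk))).
Qed.

Lemma yexp_mk k f g j : yexp (mkmon k f g) j = if (j < k)%N then g j else 0%N.
Proof.
case: ltnP => jk; last exact: yexp_ge.
by rewrite -[j]/(nat_of_ord (Ordinal jk)) yexp_ord mnmE (unsplitK (inr (Ordinal jk))).
Qed.

Lemma xexpD k (m m' : 'X_{1..k + k}) j : xexp (m + m')%MM j = (xexp m j + xexp m' j)%N.
Proof. by rewrite /xexp; case: insub => //= t; rewrite mnmDE. Qed.

Lemma yexpD k (m m' : 'X_{1..k + k}) j : yexp (m + m')%MM j = (yexp m j + yexp m' j)%N.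
Proof. by rewrite /yexp; case: insub => //= t; rewrite mnmDE. Qed.

Lemma xexpMn k (m : 'X_{1..k + k}) e j : xexp (m *+ e)%MM j = (xexp m j * e)%N.
Proof. by rewrite /xexp; case: insub => //= t; rewrite mulmnE. Qed.

Lemma yexpMn k (m : 'X_{1..k + k}) e j : yexp (m *+ e)%MM j = (yexp m j * e)%N.
Proof. by rewrite /yexp; case: insub => //= t; rewrite mulmnE. Qed.

(** A substitution acts linearly on exponents, with the variables of index [t]
    in both families replaced by the monomials [W (lshift i t)] and
    [W (rshift i t)]. *)
Lemma xexp_subst k i (W : 'I_(i + i) -> 'X_{1..k + k}) (a : 'X_{1..i + i}) j :
  xexp (\sum_(s < i + i) W s *+ a s)%MM j =
  (\sum_(t < i) xexp (W (lshift i t)) j * xexp a t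
   + \sum_(t < i) xexp (W (rshift i t)) j * yexp a t)%N.
Proof.
rewrite (big_morph (fun m : 'X_{1..k + k} => xexp m j) (fun m m' => xexpD m m' j) (id1 := 0%N)).
  rewrite big_split_ord /=; congr addn; apply: eq_bigr => t _;
  by rewrite xexpMn ?xexp_ord ?yexp_ord.
by rewrite /xexp; case: insub => //= t; rewrite mnm0E.
Qed.

Lemma yexp_subst k i (W : 'I_(i + i) -> 'X_{1..k + k}) (a : 'X_{1..i + i}) j :
  yexp (\sum_(s < i + i) W s *+ a s)%MM j =
  (\sum_(t < i) yexp (W (lshift i t)) j * xexp a t
   + \sum_(t < i) yexp (W (rshift i t)) j * yexp a t)%N.
Proof.
rewrite (big_morph (fun m : 'X_{1..k + k} => yexp m j) (fun m m' => yexpD m m' j) (id1 := 0%N)).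
  rewrite big_split_ord /=; congr addn; apply: eq_bigr => t _;
  by rewrite yexpMn ?xexp_ord ?yexp_ord.
by rewrite /yexp; case: insub => //= t; rewrite mnm0E.
Qed.

Lemma xvar_mon k j : (j < k)%N ->
  xvar k j.+1 = mfps_mon int (mkmon k (fun t => t == j) (fun=> 0%N)).
Proof.
move=> jk; rewrite /= insubT /=.
rewrite -[LHS]/(mfps_mon int U_(lshift k (Ordinal jk))); congr mfps_mon.
apply: eq_xyexp => t tk; rewrite xexp_mk yexp_mk tk.
rewrite -[t]/(nat_of_ord (Ordinal tk)) xexp_ord yexp_ord !mnm1E eq_lshift eq_lrshift.
by rewrite eq_sym.
Qed.

Lemma yvar_mon k j : (j < k)%N ->
  yvar k j.+1 = mfps_mon int (mkmon k (fun=> 0%N) (fun t => t == j)).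
Proof.
move=> jk; rewrite /= insubT /=.
rewrite -[LHS]/(mfps_mon int U_(rshift k (Ordinal jk))); congr mfps_mon.
apply: eq_xyexp => t tk; rewrite xexp_mk yexp_mk tk.
rewrite -[t]/(nat_of_ord (Ordinal tk)) xexp_ord yexp_ord !mnm1E eq_rshift eq_rlshift.
by rewrite eq_sym.
Qed.

Lemma p_mon k r : (r <= k)%N ->
  p_ k r = mfps_mon int (mkmon k (fun t => t < r)%N (fun=> 0%N)).
Proof.
rewrite /p_; elim: r => [|r IHr] rk.
  rewrite big_geq // -mfps_mon0; congr mfps_mon; apply: eq_xyexp => t tk.
  by rewrite xexp_mk yexp_mk !tk /xexp /yexp insubT /= !mnm0E.
rewrite big_nat_recr // IHr 1?ltnW // xvar_mon //= -mfps_monD; congr mfps_mon.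
apply: eq_xyexp => t tk; rewrite xexpD yexpD !xexp_mk !yexp_mk tk; lia.
Qed.

Lemma q_mon k r : (r <= k)%N ->
  q_ k r = mfps_mon int (mkmon k (fun=> 0%N) (fun t => t < r)%N).
Proof.
rewrite /q_; elim: r => [|r IHr] rk.
  rewrite big_geq // -mfps_mon0; congr mfps_mon; apply: eq_xyexp => t tk.
  by rewrite xexp_mk yexp_mk !tk /xexp /yexp insubT /= !mnm0E.
rewrite big_nat_recr // IHr 1?ltnW // yvar_mon //= -mfps_monD; congr mfps_mon.
apply: eq_xyexp => t tk; rewrite xexpD yexpD !xexp_mk !yexp_mk tk; lia.
Qed.

(** * The series Q and its substitutions *)

(** The pairs (lambda, mu) with mu <= lambda and lambda with exactly [i] parts, as
    monomials in the variables for [k]. *)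
Definition young_pairs k i : set 'X_{1..k + k} := [set m |
  [/\ forall j, (0 < xexp m j)%N = (j < i)%N,
      forall j l, (j <= l)%N -> (xexp m l <= xexp m j)%N,
      forall j l, (j <= l)%N -> (yexp m l <= yexp m j)%N
    & forall j, (yexp m j <= xexp m j)%N]]%classic.

Arguments young_pairs : clear implicits.

Lemma sorted_geqP k (f : nat -> nat) : (forall j, (k <= j)%N -> f j = 0%N) ->
  reflect (forall j l, (j <= l)%N -> (f l <= f j)%N)
          (sorted geq [tuple f j | j < k]).
Proof.
move=> f0.
have nthf j : nth 0%N [tuple f j | j < k] j = f j.
  have [jk|kj] := ltnP j k; last by rewrite nth_default ?f0 // size_tuple.
  exact: (nth_mktuple (fun t : 'I_k => f t) 0%N (Ordinal jk)).
apply: (iffP (sortedP 0%N)) => [h|h j _]; last first.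
  by rewrite !nthf; apply: h.
move=> j l jl; rewrite -(subnKC jl); elim: (l - j)%N => [|d IHd]; first by rewrite addn0.
apply: leq_trans IHd; rewrite addnS.
have [lt|ge] := ltnP (j + d).+1 k; last by rewrite f0.
by have := h (j + d)%N; rewrite size_tuple !nthf; apply.
Qed.

Lemma Q_genfun k : Q k = genfun (young_pairs k k).
Proof.
apply: mfpsP => m; rewrite mfcoef_Q /=; congr (_%:R); congr nat_of_bool.
set l := [tuple _ | j < k]; set u := [tuple _ | j < k].
have lE : l = [tuple xexp m j | j < k].
  by apply: eq_from_tnth => j; rewrite !tnth_mktuple xexp_ord.
have uE : u = [tuple yexp m j | j < k].
  by apply: eq_from_tnth => j; rewrite !tnth_mktuple yexp_ord.
apply/andP/asboolP.
  rewrite !inE lE uE /= => -[/andP[/(sorted_geqP (@xexp_ge k m)) sx /all_tnthP px]].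
  move=> /andP[/(sorted_geqP (@yexp_ge k m)) sy /forallP yx].
  split=> // j.
    have [jk|kj] := ltnP j k; last by rewrite xexp_ge.
    by have := px (Ordinal jk); rewrite tnth_mktuple.
  have [jk|kj] := ltnP j k; last by rewrite yexp_ge.
  by have := yx (Ordinal jk); rewrite !tnth_mktuple.
move=> [px sx sy yx]; rewrite !inE lE uE /=; split; apply/andP; split.
- exact/(sorted_geqP (@xexp_ge k m)).
- by apply/all_tnthP => j; rewrite tnth_mktuple /= px.
- exact/(sorted_geqP (@yexp_ge k m)).
- by apply/forallP => j; rewrite !tnth_mktuple.
Qed.

(** Used to collapse the sums of [xexp_subst] when each variable is replaced by a
    variable; the truth value of an equality serves as a Kronecker delta. *)
Lemma sum_delta i (j : nat) (f : nat -> nat) : (forall t, (i <= t)%N -> f t = 0%N) ->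
  (\sum_(t < i) (j == t) * f t)%N = f j.
Proof.
move=> f0; have [ji|ij] := ltnP j i.
  rewrite (bigD1 (Ordinal ji)) //= eqxx mul1n big1 ?addn0 // => t /negP tj.
  by case: eqP => // jt; case: tj; apply/eqP/val_inj.
rewrite f0 // big1 // => t _; case: eqP => // jt.
by have := ltn_ord t; rewrite -jt ltnNge ij.
Qed.

(** The map [phi] is given by its exponents, so that a closed form of the
    substitution can be supplied at once. *)
Lemma Q_at_genfun k i (u v : nat -> mfps (k + k) int) (U V : nat -> 'X_{1..k + k})
    (phi : 'X_{1..i + i} -> 'X_{1..k + k}) :
  (forall t, (t < i)%N -> u t.+1 = mfps_mon int (U t)) ->
  (forall t, (t < i)%N -> v t.+1 = mfps_mon int (V t)) ->
  (forall a j, (j < k)%N -> xexp (phi a) j =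
    (\sum_(t < i) xexp (U t) j * xexp a t + \sum_(t < i) xexp (V t) j * yexp a t)%N) ->
  (forall a j, (j < k)%N -> yexp (phi a) j =
    (\sum_(t < i) yexp (U t) j * xexp a t + \sum_(t < i) yexp (V t) j * yexp a t)%N) ->
  (forall a b, young_pairs i i a -> young_pairs i i b -> phi a = phi b -> a = b) ->
  Q_at i u v = genfun (phi @` young_pairs i i)%classic.
Proof.
move=> uU vV phix phiy inj.
pose W (s : 'I_(i + i)) : 'X_{1..k + k} :=
  match fintype.split s with inl t => U t | inr t => V t end.
have phiE a : phi a = (\sum_(s < i + i) W s *+ a s)%MM.
  apply: eq_xyexp => j jk; rewrite phix // phiy // xexp_subst yexp_subst.
  by split; congr addn; apply: eq_bigr => t _; rewrite /W ?(unsplitK (inl t)) ?(unsplitK (inr t)).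
have -> : phi = (fun a : 'X_{1..i + i} => \sum_(s < i + i) W s *+ a s)%MM by apply/funext.
rewrite /Q_at Q_genfun; apply: genfun_comp => [s|a b Sa Sb]; last by rewrite -!phiE; apply: inj.
by rewrite /W; case: (fintype.split s) => t; rewrite ?uU ?vV.
Qed.

Lemma Q_sub_genfun k i : (i <= k)%N -> Q_sub k i = genfun (young_pairs k i).
Proof.
move=> ik; rewrite /Q_sub.
rewrite (@Q_at_genfun _ _ _ _ (fun t => mkmon k (fun j => j == t) (fun=> 0%N))
   (fun t => mkmon k (fun=> 0%N) (fun j => j == t)) (fun a => mkmon k (xexp a) (yexp a))).
- congr genfun; apply/seteqP; split=> [_ /= [a [h1 h2 h3 h4] <-]|m [h1 h2 h3 h4]].
    split=> [j|j l jl|j l jl|j]; rewrite ?xexp_mk ?yexp_mk.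
    + have := h1 j; do ?case: ifP => *; lia.
    + by have := h2 j l jl; do ?case: ifP => *; lia.
    + by have := h3 j l jl; do ?case: ifP => *; lia.
    + by case: ifP.
  have y0 j : (i <= j)%N -> xexp m j = 0%N /\ yexp m j = 0%N.
    by move=> ij; have := h1 j; have := h4 j; lia.
  have E : mkmon k (xexp (mkmon i (xexp m) (yexp m))) (yexp (mkmon i (xexp m) (yexp m))) = m.
    apply: eq_xyexp => j jk; rewrite !xexp_mk !yexp_mk jk.
    by case: ltnP => // /y0[-> ->].
  exists (mkmon i (xexp m) (yexp m)) => //.
  split=> [j|j l jl|j l jl|j]; rewrite ?xexp_mk ?yexp_mk.
  + by have := h1 j; case: ifP => *; lia.
  + by have := h2 j l jl; do ?case: ifP => *; lia.
  + by have := h3 j l jl; do ?case: ifP => *; lia.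
  + by case: ifP.
- by move=> t ti; rewrite xvar_mon // (leq_trans ti).
- by move=> t ti; rewrite yvar_mon // (leq_trans ti).
- move=> a j jk; rewrite xexp_mk jk.
  rewrite [X in (_ + X)%N]big1 => [|t _]; last by rewrite xexp_mk jk mul0n.
  rewrite addn0 -[LHS](@sum_delta i) => [|t]; last exact: xexp_ge.
  by apply: eq_bigr => t _; rewrite xexp_mk jk.
- move=> a j jk; rewrite yexp_mk jk.
  rewrite big1 => [|t _]; last by rewrite yexp_mk jk mul0n.
  rewrite add0n -[LHS](@sum_delta i) => [|t]; last exact: yexp_ge.
  by apply: eq_bigr => t _; rewrite yexp_mk jk.
- move=> a b _ _ ab; apply: eq_xyexp => j ji.
  have := congr1 (fun m => xexp m j) ab; have := congr1 (fun m => yexp m j) ab.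
  by rewrite /= !xexp_mk !yexp_mk (leq_trans ji ik).
Qed.

(** A pair on the indices from [r] on, with its first part repeated in both
    partitions at all the smaller indices: this is the effect of replacing the
    first variable by p_(r+1) q_r.  For [r = k] the value [xexp m r] is 0, and
    only the trivial monomial is left, in agreement with Q_0 = 1. *)
Definition shifted_pairs k r : set 'X_{1..k + k} := [set m |
  [/\ forall j, (j < r)%N -> xexp m j = xexp m r /\ yexp m j = xexp m r,
      forall j, (r <= j)%N -> (0 < xexp m j)%N = (j < k)%N,
      forall j l, (r <= j <= l)%N -> (xexp m l <= xexp m j)%N,
      forall j l, (r <= j <= l)%N -> (yexp m l <= yexp m j)%N
    & forall j, (r <= j)%N -> (yexp m j <= xexp m j)%N]]%classic.

Arguments shifted_pairs : clear implicits.

Lemma Q_Zhat_genfun k r : (r <= k)%N -> Q_Zhat k r = genfun (shifted_pairs k r).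
Proof.
move=> rk; rewrite /Q_Zhat.
rewrite (@Q_at_genfun _ _ _ _
   (fun t => mkmon k (fun j => if t == 0%N then (j <= r)%N else j == r + t)%N
                     (fun j => (t == 0%N) && (j < r)%N))
   (fun t => mkmon k (fun=> 0%N) (fun j => j == r + t)%N)
   (fun a => mkmon k (fun j => xexp a (j - r))
                     (fun j => if (j < r)%N then xexp a 0 else yexp a (j - r)))).
(* The truncated subtraction [j - r] gives the first part for all [j <= r]. *)
- congr genfun; apply/seteqP; split=> [_ /= [a [h1 h2 h3 h4] <-]|m [h0 h1 h2 h3 h4]].
    split=> [j jr|j rj|j l jl|j l jl|j rj]; rewrite ?xexp_mk ?yexp_mk.
    + have -> : (j - r = 0)%N by lia.
      rewrite jr subnn (leq_trans jr rk).
      by case: ltnP => // kr; have := h1 0%N; lia.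
    + have := h1 (j - r)%N; do ?case: ifP => *; lia.
    + by have := h2 (j - r)%N (l - r)%N; do ?case: ifP => *; lia.
    + by have := h3 (j - r)%N (l - r)%N; do ?case: ifP => *; lia.
    + by have := h4 (j - r)%N; do ?case: ifP => *; lia.
  pose a := mkmon (k - r) (fun j => xexp m (r + j)) (fun j => yexp m (r + j)).
  have x0 j : (k <= j)%N -> xexp m j = 0%N by apply: xexp_ge.
  have y0 j : (k <= j)%N -> yexp m j = 0%N by apply: yexp_ge.
  exists a.
    split=> [j|j l jl|j l jl|j]; rewrite ?xexp_mk ?yexp_mk.
    + by have := h1 (r + j)%N; do ?case: ifP => *; lia.
    + by have := h2 (r + j)%N (r + l)%N; do ?case: ifP => *; lia.
    + by have := h3 (r + j)%N (r + l)%N; do ?case: ifP => *; lia.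
    + by have := h4 (r + j)%N; do ?case: ifP => *; lia.
  apply: eq_xyexp => j jk; rewrite !xexp_mk !yexp_mk jk.
  case: (ltnP j r) => [jr|rj].
    have [-> ->] := h0 j jr; have -> : (j - r = 0)%N by lia.
    by rewrite addn0; case: ltnP => //; have := x0 r; lia.
  by rewrite subnKC //; do ?case: ifP => *; lia.
- case=> [|t] tk /=.
    rewrite p_mon ?q_mon //; last by lia.
    rewrite -mfps_monD; congr mfps_mon; apply: eq_xyexp => j jk.
    by rewrite xexpD yexpD !xexp_mk !yexp_mk jk; lia.
  by rewrite addnS xvar_mon -?addnS //; lia.
- by move=> t tk; rewrite addnS yvar_mon //; lia.
- move=> a j jk; rewrite xexp_mk jk.
  rewrite [X in (_ + X)%N]big1 => [|t _]; last by rewrite xexp_mk jk mul0n.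
  rewrite addn0 -[LHS](@sum_delta (k - r)) => [|t]; last exact: xexp_ge.
  apply: eq_bigr => t _; rewrite xexp_mk jk; case: ifP; lia.
- move=> a j jk; rewrite yexp_mk jk.
  have [jr|rj] := ltnP j r.
    rewrite [X in (_ + X)%N]big1 => [|t _]; last by rewrite yexp_mk jk; lia.
    rewrite addn0 -[LHS](@sum_delta (k - r)) => [|t]; last exact: xexp_ge.
    apply: eq_bigr => t _; rewrite yexp_mk jk; lia.
  rewrite big1 => [|t _]; last by rewrite yexp_mk jk; lia.
  rewrite add0n -[LHS](@sum_delta (k - r)) => [|t]; last exact: yexp_ge.
  by apply: eq_bigr => t _; rewrite yexp_mk jk; lia.
- move=> a b _ _ ab; apply: eq_xyexp => j ji.
  have := congr1 (fun m => xexp m (r + j)) ab.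
  have := congr1 (fun m => yexp m (r + j)) ab.
  rewrite /= !xexp_mk !yexp_mk addKn.
  have -> : (r + j < k)%N by lia.
  by have -> : (r + j < r)%N = false by lia.
Qed.

(** * The terms R *)

Lemma mkmon_neq0 k f g j : (j < k)%N -> (0 < f j)%N -> mkmon k f g != 0%MM.
Proof.
move=> jk fj; apply/eqP => /(congr1 (fun m => xexp m j)).
rewrite xexp_mk jk /xexp insubT /= mnm0E => f0; by rewrite f0 in fj.
Qed.

Lemma geom_p_genfun k : (0 < k)%N -> mfps_geom (p_ k k) =
  genfun [set m | exists a, forall j, (j < k)%N -> xexp m j = a /\ yexp m j = 0%N]%classic.
Proof.
move=> k0; rewrite p_mon // genfun_geom; last by apply: (@mkmon_neq0 _ _ _ 0%N); rewrite ?k0.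
congr genfun; apply/seteqP; split=> [_ [e _ <-]|m [a h]].
  exists e => j jk; rewrite xexpMn yexpMn xexp_mk yexp_mk jk; lia.
exists a => //; apply: eq_xyexp => j jk; have := h j jk.
rewrite xexpMn yexpMn xexp_mk yexp_mk jk; lia.
Qed.

(** At least one full column of lambda and, besides the full ones, one more
    column of height [r] in mu than in lambda: the monomials of
    p_k q_r / ((1 - p_k) (1 - p_r q_r)). *)
Definition columns k r : set 'X_{1..k + k} := [set m | exists a b, forall j, (j < k)%N ->
  xexp m j = (a.+1 + b * (j < r))%N /\ yexp m j = (b.+1 * (j < r))%N]%classic.
Arguments columns : clear implicits.

Lemma columns_genfun k r : (0 < r <= k)%N ->
  p_ k k * q_ k r * (mfps_geom (p_ k k) * mfps_geom (p_ k r * q_ k r)) = genfun (columns k r).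
Proof.
move=> /andP[r0 rk]; have k0 : (0 < k)%N by lia.
rewrite geom_p_genfun // !p_mon // q_mon // -!mfps_monD genfun_geom; last first.
  apply/eqP => /(congr1 (fun m => xexp m 0%N)).
  by rewrite xexpD !xexp_mk k0 r0 /xexp insubT /= mnm0E.
set c := (_ + _)%MM; set d := (_ + _)%MM.
have xc j : (j < k)%N -> xexp c j = 1%N by move=> jk; rewrite xexpD !xexp_mk jk.
have yc j : (j < k)%N -> yexp c j = (j < r)%N by move=> jk; rewrite yexpD !yexp_mk jk.
have xd j : (j < k)%N -> xexp d j = (j < r)%N.
  by move=> jk; rewrite xexpD !xexp_mk jk addn0.
have yd j : (j < k)%N -> yexp d j = (j < r)%N by move=> jk; rewrite yexpD !yexp_mk jk.
rewrite (@genfun_mul _ _ _ [set m | exists a b, forall j, (j < k)%N ->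
  xexp m j = (a + b * (j < r))%N /\ yexp m j = (b * (j < r))%N]%classic).
- rewrite genfun_mon; apply: genfun_mul => [s t s' t' -> _ -> //|m].
  split=> [[a [b h]]|[_ [t [-> [a [b h]] ->]]]]; last first.
    by exists a, b => j jk; rewrite xexpD yexpD xc ?yc //; have := h j jk; nia.
  exists c, (mkmon k (fun j => a + b * (j < r))%N (fun j => b * (j < r))%N).
  split=> //; first by exists a, b => j jk; rewrite xexp_mk yexp_mk jk.
  apply: eq_xyexp => j jk; have := h j jk.
  rewrite xexpD yexpD xc ?yc // xexp_mk yexp_mk jk; nia.
- move=> s t s' t' [a h] [e _ <-] [a' h'] [e' _ <-] E; apply: eq_xyexp => j jk.
  have := congr1 (fun m => xexp m 0%N) E; have := congr1 (fun m => yexp m 0%N) E.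
  rewrite /= !xexpD !yexpD !xexpMn !yexpMn !xd ?yd // r0.
  have := h j jk; have := h' j jk; have := h 0%N k0; have := h' 0%N k0; lia.
- move=> m; split=> [[a [b h]]|[s [t [[a h] [e _ <-] ->]]]]; last first.
    exists a, e => j jk; rewrite xexpD yexpD xexpMn yexpMn xd ?yd //.
    by have := h j jk; nia.
  exists (mkmon k (fun=> a) (fun=> 0%N)), (d *+ b)%MM; split.
  + by exists a => j jk; rewrite xexp_mk yexp_mk jk.
  + by exists b.
  + apply: eq_xyexp => j jk; have := h j jk.
    rewrite xexpD yexpD xexpMn yexpMn xd ?yd // xexp_mk yexp_mk jk; nia.
Qed.

(** With D the difference lambda - mu at the r-th part, the middle conditions say
    that D is the minimum of the differences, attained for the last time there,
    and that the later parts of lambda exceed D + 1; the last one says that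
    exactly [i] parts exceed the r-th one.  They are written without subtractions
    of natural numbers. *)
Definition last_min_pairs k i r : set 'X_{1..k + k} := [set m | young_pairs k k m /\
  let: x := xexp m in let: y := yexp m in
  [/\ (0 < y r.-1)%N,
      forall j, (j < r)%N -> (y j + x r.-1 <= x j + y r.-1)%N,
      forall j, (r <= j < k)%N -> (y j + x r.-1 < x j + y r.-1)%N,
      forall j, (r <= j < k)%N -> (x r.-1 + 1 < x j + y r.-1)%N
    & forall j, (j < r)%N -> (x r.-1 < x j)%N = (j < i)%N]]%classic.
Arguments last_min_pairs : clear implicits.

(** Adding the factors of [R_ i r k] gives a pair as described by
    [last_min_pairs], and the factors are read off from such a pair at the r-th
    part, where the pair with [i] parts contributes nothing because [i < r]. *)
Lemma R_genfun k i r : (i < r <= k)%N -> R_ i r k = genfun (last_min_pairs k i r).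
Proof.
move=> /andP[ir rk]; have rk' : (r.-1 < k)%N by lia.
rewrite /R_ columns_genfun ?Q_sub_genfun ?Q_Zhat_genfun //; try lia.
rewrite (@genfun_mul _ _ _ [set m | exists s t,
  [/\ columns k r s, young_pairs k i t & m = (s + t)%MM]]%classic) //; last first.
  move=> s t s' t' [a [b h]] [h1 h2 h3 h4] [a' [b' h']] [h1' h2' h3' h4'] E.
  have Ex j := congr1 (fun m => xexp m j) E; have Ey j := congr1 (fun m => yexp m j) E.
  have := Ex r.-1; have := Ey r.-1; rewrite /= !xexpD !yexpD.
  have := h r.-1 rk'; have := h' r.-1 rk'.
  have := h1 r.-1; have := h1' r.-1; have := h4 r.-1; have := h4' r.-1.
  move=> *; apply: eq_xyexp => j jk; have := h j jk; have := h' j jk; nia.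
apply: genfun_mul.
  move=> w z w' z' [s [t [[a [b h]] [h1 _ _ h4] ->]]] [z0 z1 z2 z3 z4].
  move=> [s' [t' [[a' [b' h']] [h1' _ _ h4'] ->]]] [z0' z1' z2' z3' z4'] E.
  suff zz : z = z' by move: E; rewrite zz => /addIm.
  have Ex j := congr1 (fun m => xexp m j) E; have Ey j := congr1 (fun m => yexp m j) E.
  rewrite /= in Ex Ey.
  (* At [r.-1] the exponent of x exceeds that of y by [a], whatever [b] and [z]. *)
  have aa : a = a'.
    have := Ex r.-1; have := Ey r.-1; rewrite !xexpD !yexpD.
    have := h r.-1 rk'; have := h' r.-1 rk'; have := z0 r.-1; have := z0' r.-1.
    have := h1 r.-1; have := h1' r.-1; have := h4 r.-1; have := h4' r.-1; nia.
  have Zx j : (r <= j)%N -> xexp z j = xexp z' j /\ yexp z j = yexp z' j.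
    move=> rj; have [jk|kj] := ltnP j k; last by rewrite !xexp_ge ?yexp_ge.
    have := Ex j; have := Ey j; rewrite !xexpD !yexpD.
    have := h j jk; have := h' j jk.
    have := h1 j; have := h1' j; have := h4 j; have := h4' j; nia.
  apply: eq_xyexp => j jk; have [jr|rj] := ltnP j r; last exact: Zx.
  by have := z0 j jr; have := z0' j jr; have := Zx r (leqnn r); lia.
move=> m; split; last first.
  move=> [_ [z [[s [t [[a [b h]] [h1 h2 h3 h4] ->]]] [z0 z1 z2 z3 z4] ->]]].
  set w := (_ + _ + _)%MM.
  have t0 j : (i <= j)%N -> xexp t j = 0%N /\ yexp t j = 0%N.
    by move=> ij; have := h1 j; have := h4 j; lia.
  have lo j : (j < r)%N -> xexp w j = (a.+1 + b + xexp t j + xexp z r)%N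
                        /\ yexp w j = (b.+1 + yexp t j + xexp z r)%N.
    move=> jr; have := h j (leq_trans jr rk); have := z0 j jr.
    by rewrite !xexpD !yexpD jr; lia.
  have hi j : (r <= j)%N -> (j < k)%N -> xexp w j = (a.+1 + xexp z j)%N
                        /\ yexp w j = yexp z j.
    move=> rj jk; have := h j jk; have := t0 j; rewrite !xexpD !yexpD; lia.
  have top j : (k <= j)%N -> xexp w j = 0%N /\ yexp w j = 0%N.
    by move=> kj; rewrite xexp_ge ?yexp_ge.
  have wr := lo r.-1; have tr := t0 r.-1.
  split; first split.
  - by move=> j; have := lo j; have := hi j; have := top j; lia.
  - move=> j l jl; have := lo j; have := hi j; have := top j.
    have := lo l; have := hi l; have := top l; have := h2 j l jl.
    by have := z2 j l; have := z2 r l; lia.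
  - move=> j l jl; have := lo j; have := hi j; have := top j.
    have := lo l; have := hi l; have := top l; have := h3 j l jl.
    by have := z3 j l; have := z2 r l; have := z4 l; lia.
  - move=> j; have := lo j; have := hi j; have := top j; have := h4 j.
    have := z4 j; have := tr; lia.
  split.
  - lia.
  - by move=> j jr; have := lo j jr; have := h4 j; lia.
  - by move=> j jr; have := hi j; have := z4 j; lia.
  - by move=> j jr; have := hi j; have := z1 j; lia.
  - by move=> j jr; have := lo j jr; have := h1 j; lia.
move=> [[h1 h2 h3 h4] [p1 p2 p3 p4 p5]].
have D := h4 r.-1.
(* [d] is the minimal difference, [c] the first part of the pair on the indices
   from [r] on (0 when [r = k]), and [b] the number of columns of height [r]. *)
pose d := (xexp m r.-1 - yexp m r.-1)%N.
pose c := (xexp m r - d.+1)%N.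
pose b := ((yexp m r.-1).-1 - c)%N.
exists (mkmon k (fun j => d.+1 + b * (j < r))%N (fun j => b.+1 * (j < r))%N +
  mkmon k (fun j => xexp m j - xexp m r.-1)%N
          (fun j => yexp m j - yexp m r.-1)%N)%MM.
exists (mkmon k (fun j => if (j < r)%N then c else xexp m j - d.+1)%N
          (fun j => if (j < r)%N then c else yexp m j)).
have xr j : (r <= j)%N -> (xexp m j <= xexp m r.-1)%N by move=> rj; apply: h2; lia.
have yr j : (r <= j)%N -> (yexp m j <= yexp m r.-1)%N by move=> rj; apply: h3; lia.
have xlr j : (j < r)%N -> (xexp m r.-1 <= xexp m j)%N by move=> rj; apply: h2; lia.
have ylr j : (j < r)%N -> (yexp m r.-1 <= yexp m j)%N by move=> rj; apply: h3; lia.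
split.
- exists (mkmon k (fun j => d.+1 + b * (j < r))%N (fun j => b.+1 * (j < r))%N).
  exists (mkmon k (fun j => xexp m j - xexp m r.-1)%N
          (fun j => yexp m j - yexp m r.-1)%N); split=> //.
    by exists d, b => j jk; rewrite xexp_mk yexp_mk jk.
  split.
  + move=> j; rewrite xexp_mk; have := p5 j; have := xr j.
    by case: ifP => *; lia.
  + by move=> j l jl; rewrite !xexp_mk; have := h2 j l jl; do ?case: ifP => *; lia.
  + by move=> j l jl; rewrite !yexp_mk; have := h3 j l jl; do ?case: ifP => *; lia.
  + move=> j; rewrite xexp_mk yexp_mk; have := p2 j; have := yr j.
    by case: ifP => *; lia.
- split.
  + move=> j jr; rewrite !xexp_mk !yexp_mk jr ltnn (leq_trans jr rk).
    by case: ltnP => // kr; rewrite /c xexp_ge.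
  + by move=> j rj; rewrite xexp_mk; have := p4 j; do ?case: ifP => *; lia.
  + move=> j l rjl; rewrite !xexp_mk; have := h2 j l; do ?case: ifP => *; lia.
  + move=> j l rjl; rewrite !yexp_mk; have := h3 j l; do ?case: ifP => *; lia.
  + move=> j rj; rewrite xexp_mk yexp_mk; have := p3 j; do ?case: ifP => *; lia.
- apply: eq_xyexp => j jk; rewrite !xexpD !yexpD !xexp_mk !yexp_mk jk.
  case: ltnP => jr.
    have := xlr j jr; have := ylr j jr; have := xr r (leqnn r); have := p3 r.
    have := p4 r; have := @xexp_ge k m r; lia.
  have := xr j jr; have := yr j jr; have := p4 j; lia.
Qed.

(** * The partition into classes *)

(** The pairs with mu_k = 0 and lambda_k - 1 at most every difference
    lambda_j - mu_j, so that lambda_k - 1 full columns can be removed from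
    lambda without uncovering mu. *)
Definition peelable_pairs k : set 'X_{1..k + k} := [set m |
  [/\ young_pairs k k m, yexp m k.-1 = 0%N
    & forall j, (j < k)%N -> (yexp m j + xexp m k.-1 <= xexp m j + 1)%N]]%classic.
Arguments peelable_pairs : clear implicits.

(** The exponents of the last index of both x_k and the pair with k - 1 parts are
    known, so the last part of lambda tells how many columns were added. *)
Lemma peelable_genfun k : (0 < k)%N ->
  xvar k k * Q_sub k k.-1 * mfps_geom (p_ k k) = genfun (peelable_pairs k).
Proof.
case: k => [//|k] _; rewrite xvar_mon // genfun_mon Q_sub_genfun // geom_p_genfun //.
set c := mkmon _ _ _.
have xc j : (j < k.+1)%N -> xexp c j = (j == k) by move=> jk; rewrite xexp_mk jk.
have yc j : yexp c j = 0%N by rewrite yexp_mk if_same.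
rewrite (@genfun_mul _ _ _ [set m | exists2 t, young_pairs k.+1 k t & m = (c + t)%MM]%classic);
  last 2 first.
- by move=> s t s' t' -> _ ->.
- move=> m; split=> [[t yt ->]|[_ [t [-> yt ->]]]]; first by exists c, t.
  by exists t.
have tk t j : young_pairs k.+1 k t -> (k <= j)%N -> xexp t j = 0%N /\ yexp t j = 0%N.
  by move=> [h1 _ _ h4] kj; have := h1 j; have := h4 j; lia.
apply: genfun_mul.
  move=> _ s _ s' [t yt ->] [a h] [t' yt' ->] [a' h'] E.
  have := congr1 (fun m => xexp m k) E; rewrite /= !xexpD.
  have := tk _ _ yt (leqnn k); have := tk _ _ yt' (leqnn k).
  have := h k (ltnSn k); have := h' k (ltnSn k) => hk hk' tk0 tk0' Ek.
  suff ss : s = s' by move: E; rewrite ss => /addIm.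
  by apply: eq_xyexp => j jk; have := h j jk; have := h' j jk; lia.
move=> m; split=> [[[h1 h2 h3 h4] yk ym]|[_ [s [[t yt ->] [a h] ->]]]].
  rewrite /= in yk ym.
  have xk : (0 < xexp m k)%N by rewrite h1.
  pose t := mkmon k.+1 (fun j => if j < k then xexp m j - (xexp m k).-1 else 0)%N (yexp m).
  exists (c + t)%MM, (mkmon k.+1 (fun=> (xexp m k).-1) (fun=> 0%N)); split.
  - exists t => //; split=> [j|j l jl|j l jl|j]; rewrite ?xexp_mk ?yexp_mk.
    + have := h1 j; have := h2 j k; do ?case: ifP => *; lia.
    + have := h2 j l jl; have := h2 j k; have := h2 l k; do ?case: ifP => *; lia.
    + by have := h3 j l jl; do ?case: ifP => *; lia.
    + have := ym j; have := h4 j; have := h3 k j; do ?case: ifP => *; lia.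
  - by exists (xexp m k).-1 => j jk; rewrite xexp_mk yexp_mk jk.
  - apply: eq_xyexp => j jk; rewrite !xexpD !yexpD xc // yc !xexp_mk !yexp_mk jk.
    by have := h2 j k; have := h2 k j; do ?case: ifP => *; lia.
set w := (_ + _)%MM.
have lo j : (j < k.+1)%N -> xexp w j = ((j == k) + xexp t j + a)%N /\ yexp w j = yexp t j.
  by move=> jk; have := h j jk; rewrite !xexpD !yexpD xc ?yc //; lia.
have top j : (k < j)%N -> xexp w j = 0%N /\ yexp w j = 0%N.
  by move=> kj; rewrite xexp_ge ?yexp_ge.
have tt j := tk t j yt; have lk := lo k (ltnSn k); have tk0 := tt k (leqnn k).
case: yt => [h1 h2 h3 h4].
split; first split.
- by move=> j; have := lo j; have := top j; have := h1 j; lia.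
- move=> j l jl; have := lo j; have := top j; have := lo l; have := top l.
  by have := h2 j l jl; have := h1 j; have := tt j; have := tt l; lia.
- move=> j l jl; have := lo j; have := top j; have := lo l; have := top l.
  by have := h3 j l jl; lia.
- by move=> j; have := lo j; have := top j; have := h4 j; lia.
- by rewrite /=; lia.
- by move=> j jk /=; have := lo j jk; have := h4 j; have := h1 j; lia.
Qed.

Lemma last_argmin (d : nat -> nat) n : (0 < n)%N -> exists r, [/\ (0 < r <= n)%N,
  forall j, (j < n)%N -> (d r.-1 <= d j)%N
  & forall j, (r <= j < n)%N -> (d r.-1 < d j)%N].
Proof.
elim: n => // -[_ _|n /(_ isT) [r [rn le lt]] _].
  by exists 1%N; split=> // j; case: j.
have [dn|dn] := leqP (d n.+1) (d r.-1).
  exists n.+2; split=> [|j jn|j]; rewrite ?leqnn //=; last by lia.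
  by have [->//|jn'] := eqVneq j n.+1; have := le j; lia.
exists r; split=> [|j jn|j jn]; first by lia.
  by have [->|jn'] := eqVneq j n.+1; [lia|apply: le; lia].
by have [->//|jn'] := eqVneq j n.+1; apply: lt; lia.
Qed.

(** If mu_k = 0, not being peelable means that some difference, hence also the
    minimal one D, is less than lambda_k - 1.  If mu_k > 0 and r < k then
    lambda_k = d_k + mu_k >= D + 2, as d_k > D.  Either way the parts after the
    r-th exceed D + 1; and mu_r = lambda_r - D is positive in the first case, at
    least mu_k in the second. *)
Lemma last_min_exists k m : (0 < k)%N -> young_pairs k k m -> ~ peelable_pairs k m ->
  exists i r, (i < r <= k)%N /\ last_min_pairs k i r m.
Proof.
move=> k0 ym nF; have [h1 h2 h3 h4] := ym.
have [r [/andP[r0 rk] le lt]] := last_argmin (fun j => xexp m j - yexp m j)%N k0.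
have exi : exists i, (xexp m i <= xexp m r.-1)%N by exists r.-1.
(* The parts exceeding the r-th one come first, so their number is the first
   index at which that fails. *)
case: (ex_minnP exi) => i xi mini.
have ir : (i < r)%N by have := mini r.-1; lia.
have yr := h4 r.-1; have yk := h4 k.-1.
exists i, r; split; first by rewrite ir.
have [yk0|yk0] := posnP (yexp m k.-1).
  have big : (xexp m r.-1 - yexp m r.-1 + 1 < xexp m k.-1)%N.
    rewrite ltnNge; apply/negP => small; apply: nF; split=> // j jk.
    by have := le j jk; have := h4 j; lia.
  split=> //; split.
  - by have := h2 r.-1 k.-1; lia.
  - by move=> j jr; have := le j; have := h4 j; lia.
  - by move=> j jr; have := lt j; have := h4 j; lia.
  - by move=> j jr; have := h2 j k.-1; lia.
  - by move=> j jr; have := mini j; have := h2 i j; lia.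
split=> //; split.
- by have := h3 r.-1 k.-1; lia.
- by move=> j jr; have := le j; have := h4 j; lia.
- by move=> j jr; have := lt j; have := h4 j; lia.
- by move=> j jr; have := h2 j k.-1; have := lt k.-1; lia.
- by move=> j jr; have := mini j; have := h2 i j; lia.
Qed.

Lemma last_min_uniq k i r i' r' m : (i < r <= k)%N -> (i' < r' <= k)%N ->
  last_min_pairs k i r m -> last_min_pairs k i' r' m -> i = i' /\ r = r'.
Proof.
move=> ir ir' [_ [_ p2 p3 _ p5]] [_ [_ p2' p3' _ p5']].
have rr : r = r'.
  have := p2 r'.-1; have := p3 r'.-1; have := p2' r.-1; have := p3' r.-1; lia.
subst r'; split=> //.
by have := p5 i; have := p5' i; have := p5 i'; have := p5' i'; lia.
Qed.

(** If r = k the two conditions on mu_k conflict; if r < k, then lambda_k would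
    both exceed D + 1 and be at most d_r + 1 = D + 1. *)
Lemma peelable_last_min k i r m : (i < r <= k)%N ->
  peelable_pairs k m -> ~ last_min_pairs k i r m.
Proof.
move=> ir [_ yk ym] [_ [p1 _ _ p4 _]].
have [rk|rk] := eqVneq r k; first by rewrite rk yk in p1.
by have := p4 k.-1; have := ym r.-1; lia.
Qed.

Theorem corollary5 :
  Q 0 = 1 /\
  forall k : nat, (0 < k)%N ->
    Q k = xvar k k * Q_sub k k.-1 * mfps_geom (p_ k k)
          + \sum_(1 <= r < k.+1) \sum_(0 <= i < r) R_ i r k.
Proof.
split.
  rewrite Q_genfun -mfps_mon0 genfun_mon; congr genfun; apply/seteqP; split=> m _.
    exact: (@eq_xyexp 0).
  by split=> *; rewrite ?xexp_ge ?yexp_ge.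
move=> k k0; rewrite Q_genfun peelable_genfun //; apply: mfpsP => m; rewrite mfcoefD.
pose N i r : int := `[< last_min_pairs k i r m >]%:R.
have -> : (\sum_(1 <= r < k.+1) \sum_(0 <= i < r) R_ i r k)@~m =
    \sum_(1 <= r < k.+1) \sum_(0 <= i < r) N i r.
  pose ev (f : mfps (k + k) int) := f@~m.
  have evS := big_morph ev (fun f g => mfcoefD f g m) (mfcoef0 int m).
  rewrite -[LHS]/(ev _) evS; apply: eq_big_nat => r rk.
  rewrite evS; apply: eq_big_nat => i ir; rewrite /ev R_genfun //; lia.
rewrite /=.
have N0 i r : ~ last_min_pairs k i r m -> N i r = 0.
  by move=> h; rewrite /N asboolF.
have [ym|nym] := asboolP (young_pairs k k m); last first.
  rewrite asboolF => [|[] //]; rewrite add0r.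
  rewrite big_nat big1 // => r rk; rewrite big_nat big1 // => i ir.
  by apply: N0 => -[].
have [Fm|nFm] := asboolP (peelable_pairs k m).
  rewrite big_nat big1 ?addr0 // => r rk; rewrite big_nat big1 // => i ir.
  by apply: N0; apply: peelable_last_min Fm; lia.
have [i [r [irk Lm]]] := last_min_exists k0 ym nFm.
rewrite add0r (bigD1_seq r) ?iota_uniq ?mem_index_iota //=; last by lia.
rewrite (bigD1_seq i) ?iota_uniq ?mem_index_iota //=; last by lia.
rewrite {1}/N asboolT // big_nat_cond big1 => [|i' /andP[ir' /negP ne]]; last first.
  have irk' : (i' < r <= k)%N by lia.
  by apply: N0 => Lm'; apply: ne; have [<- _] := last_min_uniq irk irk' Lm Lm'.
rewrite big_nat_cond big1 ?addr0 // => r' /andP[rk' /negP ne].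
rewrite big_nat big1 // => i' ir'; have irk' : (i' < r' <= k)%N by lia.
by apply: N0 => Lm'; apply: ne; have [_ <-] := last_min_uniq irk irk' Lm Lm'.
Qed.
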